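(* For $n\ge2$, $$\widetilde B_n(t)=\sum_{u\in S_n}\phi(u)\,(4t)^{\mathrm{epk}(u)}(1+t)^{n+1-2\,\mathrm{epk}(u)},$$ where $$\phi(u):=\begin{cases}1&\text{if }u_{n-2}>u_{n-1}>u_n,\\ 0&\text{if }u_{n-2}>u_n>u_{n-1},\\ 1/2&\text{otherwise.}\end{cases}$$ In particular, $\widetilde B_n(t)$ has a nonnegative $\gamma$-vector, i.e. in the unique expansion $\widetilde B_n(t)=\sum_{0\le i\le(n+1)/2}\gamma_it^i(1+t)^{n+1-2i}$ all $\gamma_i$ are nonnegative.
   Context: $S_n$ is the symmetric group on $\{1,\dots,n\}$, with permutations written $u=u_1\cdots u_n$ and the convention $u_0=u_{n+1}=0$ (so $\phi(u)=1/2$ for all $u\in S_2$). The number of extended peaks is $\mathrm{epk}(u):=|\{i\in\{1,\dots,n\}:u_{i-1}<u_i>u_{i+1}\}|$. The Weyl group $B_n$ is the group of signed permutations: permutations $w$ of $\{\pm1,\dots,\pm n\}$ with $w(-i)=-w(i)$, written $w=w_1\cdots w_n$ with $w_i=w(i)$. The affine descent set $\widetilde{\mathrm{Des}}(w)\subseteq\{0,1,\dots,n\}$ of $w\in B_n$ consists of all $i\in\{1,\dots,n\}$ with $w_{i-1}>w_i$ (convention $w_0=0$), together with $0$ if $w_{n-1}+w_n>0$. The affine Eulerian polynomial is $\widetilde B_n(t)=\sum_{w\in B_n}t^{|\widetilde{\mathrm{Des}}(w)|}$; it satisfies $\widetilde B_n(t)=t^{n+1}\widetilde B_n(1/t)$.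 *)

(* Defs.v *)
From mathcomp Require Import all_boot all_order all_fingroup all_algebra.

Set Implicit Arguments.
Unset Strict Implicit.
Unset Printing Implicit Defensive.

Import Order.TTheory GRing.Theory Num.Theory.
Local Open Scope ring_scope.

(* u_i in the one-line notation u_1 ... u_n with u_0 = u_(n+1) = 0; the element
   k : 'I_n stands for k + 1 in {1, ..., n}. *)
Definition entry (n : nat) (u : 'S_n) (i : nat) : nat :=
  if i is j.+1 then
    if insub j : option 'I_n is Some k then (u k).+1 else 0%N
  else 0%N.

(* Extended peaks are pairwise non-adjacent elements of {1, ..., n}, so that
   2 * epk u <= n + 1. *)
Definition epk (n : nat) (u : 'S_n) : nat :=
  #|[set i : 'I_n.+1 | (1 <= i)%N && (entry u i.-1 < entry u i)%N
                       && (entry u i.+1 < entry u i)%N]|.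

Definition phi (n : nat) (u : 'S_n) : rat :=
  let a := entry u (n - 2) in
  let b := entry u (n - 1) in
  let c := entry u n in
  if (a > b)%N && (b > c)%N then 1
  else if (a > c)%N && (c > b)%N then 0
  else 1 / 2.

(* (k, false) and (k, true) stand for k + 1 and - (k + 1) respectively. *)
Definition signed (n : nat) : finType := ('I_n * bool)%type.

Definition signed_val (n : nat) (x : signed n) : int :=
  (-1) ^+ x.2 * (x.1.+1)%:Z.

Definition signed_opp (n : nat) (x : signed n) : signed n := (x.1, ~~ x.2).

Definition signed_perms (n : nat) : {set {perm signed n}} :=
  [set w : {perm signed n} | [forall x, w (signed_opp x) == signed_opp (w x)]].

(* w_i = w(i) for 1 <= i <= n, with w_0 = 0. *)
Definition sentry (n : nat) (w : {perm signed n}) (i : nat) : int :=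
  if i is j.+1 then
    if insub j : option 'I_n is Some k then signed_val (w (k, false)) else 0
  else 0.

Definition affDes (n : nat) (w : {perm signed n}) : {set 'I_n.+1} :=
  [set i : 'I_n.+1 |
    if (i == 0 :> nat)%N then sentry w (n - 1) + sentry w n > 0
    else sentry w i.-1 > sentry w i].

Definition affine_Eulerian (n : nat) : {poly rat} :=
  \sum_(w in signed_perms n) 'X^(#|affDes w|).

Definition gamma_expansion (d : nat) (p : {poly rat})
    (gamma : {ffun 'I_(d./2).+1 -> rat}) : Prop :=
  p = \sum_(i < (d./2).+1) gamma i *: ('X^i * (1 + 'X) ^+ (d - 2 * i)).

(* Main.v *)
(* Write a signed permutation as a permutation u together with a choice of signs.
   For fixed u, each affine descent is decided by the sign of one letter, so the
   sum over the signs is a product of one factor per letter.  Up to the last two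
   letters the factors are 2X for peaks, 2 for valleys and 1 + X otherwise, as
   in half the product (4X)^epk (1 + X)^(n + 1 - 2 epk).  The sum over the signs
   differs from phi u times this product only when the last two letters b, c are
   both smaller than the letter before them, by 4X or -4X times the preceding
   factors; swapping b and c changes the sign of this defect. *)
Require Import Defs.
From mathcomp Require Import all_boot all_order all_fingroup all_algebra.
From mathcomp Require Import ring zify.
Import Order.TTheory GRing.Theory Num.Theory.
Local Open Scope ring_scope.

Local Arguments entry : simpl never.
Local Arguments sentry : simpl never.

(** * Entries of the one-line notation *)

Lemma entryS n (u : 'S_n) (k : 'I_n) : entry u k.+1 = (u k).+1.
Proof. by rewrite /entry valK. Qed.

Lemma entry_out n (u : 'S_n) : entry u n.+1 = 0%N.
Proof. by rewrite /entry insubF // ltnn. Qed.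

Lemma entry_gt0 n (u : 'S_n) j : (j < n)%N -> (0 < entry u j.+1)%N.
Proof. by move=> lt_jn; rewrite (entryS _ _ (Ordinal lt_jn)). Qed.

Lemma entry_neq n (u : 'S_n) j : (0 < n)%N -> (j <= n)%N ->
  entry u j != entry u j.+1.
Proof.
case: n u => // n u _; case: j => [|j] le_jn.
  by have := @entry_gt0 n.+1 u 0 isT; case: (entry u 1).
have [lt_jn | ge_jn] := ltnP j n; last first.
  have -> : j = n by apply/eqP; rewrite eqn_leq ge_jn andbT -ltnS.
  by rewrite entry_out -lt0n entry_gt0.
rewrite (entryS _ _ (Ordinal le_jn)) (entryS _ _ (@Ordinal n.+1 j.+1 lt_jn)).
rewrite eqSS (inj_eq val_inj) (inj_eq perm_inj) -val_eqE /=.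
by rewrite neq_ltn leqnn.
Qed.

Lemma epkE n (u : 'S_n) :
  epk u = (\sum_(j < n) ((entry u j < entry u j.+1) &&
                         (entry u j.+2 < entry u j.+1)))%N.
Proof.
rewrite /epk -sum1dep_card big_mkcond big_ord_recl /= add0n.
by apply: eq_bigr => j _ /=; case: ifP.
Qed.

(** * Peaks, valleys and the product of letter weights *)

Definition letter_weight (e : nat -> nat) (j : nat) : {poly rat} :=
  'X^(e j < e j.+1)%N + 'X^(e j.+2 < e j.+1)%N.

(* Peaks and valleys alternate, so with p peaks there are p - d valleys. *)
Lemma prod_letter_weight (e : nat -> nat) m
    (p := (\sum_(j < m) ((e j < e j.+1) && (e j.+2 < e j.+1)))%N)
    (d := (e m.+1 < e m)%N : nat) :
  (e 0 < e 1)%N -> (forall j, (j <= m)%N -> e j != e j.+1) ->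
  (2 * p <= m + d)%N /\
  2 ^+ d * \prod_(j < m) letter_weight e j
    = (4 *: 'X) ^+ p * (1 + 'X) ^+ (m + d - 2 * p).
Proof.
have X4 : 4 *: 'X = 4 * 'X :> {poly rat} by rewrite -mul_polyC polyC_natr.
rewrite {}/p {}/d X4 => e01; elim: m => [|m IHm] e_neq.
  by rewrite !big_ord0 (leq_gtF (ltnW e01)) !expr0 !mulr1.
have [j le_jm|] := IHm; first by apply: e_neq; rewrite ltnW.
rewrite !big_ord_recr /=; set p := (\sum_(_ < m) _)%N; set P := \prod_(_ < m) _.
have := e_neq m.+1 (leqnn _); have := e_neq m (leqnSn m).
rewrite /letter_weight; case: (ltngtP (e m) (e m.+1)) => // _ _;
  case: (ltngtP (e m.+1) (e m.+2)) => // _ _ /=;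
  rewrite ?addn0 ?addn1 ?expr0 ?expr1 ?mul1r => le_p EP; split; try lia.
(* The cases are double ascent, peak, valley and double descent at [m.+1]. The exponent [d] rises to
   1 at a peak, and the next valley pays its factor 2 out of [2 ^+ d]. *)
- rewrite EP; have -> : (m.+1 - 2 * p = (m - 2 * p).+1)%N by lia.
  by rewrite exprS; ring.
- rewrite EP; have -> : (m.+2 - 2 * p.+1 = m - 2 * p)%N by lia.
  by rewrite exprS; ring.
- by rewrite -EP; ring.
- rewrite mulrA EP; have -> : (m.+2 - 2 * p = (m.+1 - 2 * p).+1)%N by lia.
  by rewrite exprS; ring.
Qed.

(** * Signed permutations as permutations with signs *)

Section SignedPermutations.

Variable n : nat.

Definition attach_signs_fun (u : 'S_n) (eps : {ffun 'I_n -> bool})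
  (x : signed n) : signed n := (u x.1, x.2 (+) eps x.1).

Lemma attach_signs_inj u eps : injective (attach_signs_fun u eps).
Proof.
move=> [i s] [j t] [] /= /perm_inj -> /eqP.
by rewrite (inj_eq (@addIb _)) => /eqP ->.
Qed.

Definition attach_signs u eps : {perm signed n} := perm (@attach_signs_inj u eps).

Lemma attach_signsE u eps i s :
  attach_signs u eps (i, s) = (u i, s (+) eps i).
Proof. by rewrite permE. Qed.

Lemma attach_signs_surj (w : {perm signed n}) :
  w \in signed_perms n -> exists u eps, w = attach_signs u eps.
Proof.
rewrite inE => /forallP w_opp.
pose f i := (w (i, false)).1.
have wE i s : w (i, s) = (f i, s (+) (w (i, false)).2).
  case: s; last by case Ew: (w _) => [a b]; rewrite /f Ew.
  by have /eqP := w_opp (i, false); rewrite /signed_opp.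
have f_inj : injective f.
  move=> i j eq_f.
  (* Giving [i] the sign of its own image makes the image positive, so that equal absolute values
     give equal images. *)
  suff [] : (i, (w (i, false)).2) = (j, (w (j, false)).2) by [].
  by apply: (@perm_inj _ w); rewrite (wE i) (wE j) eq_f !addbb.
exists (perm f_inj), [ffun i => (w (i, false)).2].
by apply/permP => -[i s]; rewrite attach_signsE permE ffunE (wE i s).
Qed.

Lemma sum_signed_perms (R : nmodType) (F : {perm signed n} -> R) :
  \sum_(w in signed_perms n) F w
    = \sum_(u : 'S_n) \sum_(eps : {ffun 'I_n -> bool}) F (attach_signs u eps).
Proof.
rewrite pair_big /=.
pose h (x : 'S_n * {ffun 'I_n -> bool}) := attach_signs x.1 x.2.
have h_inj : injective h.
  move=> [u eps] [v eta] /permP eq_h.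
  have {}eq_h i : u i = v i /\ eps i = eta i.
    by have := eq_h (i, false); rewrite !attach_signsE /= => -[-> ->].
  by congr pair; [apply/permP | apply/ffunP] => i; case: (eq_h i).
rewrite -(big_imset _ (in2W h_inj)); apply: eq_bigl => w.
apply/idP/imsetP => [/attach_signs_surj [u [eps ->]] | [[u eps] _ ->]].
  by exists (u, eps).
rewrite inE; apply/forallP => -[i s]; rewrite /h /signed_opp /=.
by rewrite !attach_signsE /= addNb.
Qed.

Definition sign_at (eps : {ffun 'I_n -> bool}) (i : nat) : bool :=
  if i is j.+1 then
    if insub j : option 'I_n is Some k then eps k else false
  else false.

Lemma sentry_attach_signs u eps i :
  sentry (attach_signs u eps) i = (-1) ^+ sign_at eps i * (entry u i)%:Z.
Proof.
rewrite /sentry /entry /sign_at; case: i => [|j] //.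
case: insubP => [k _ _|_]; last by rewrite mulr0.
by rewrite attach_signsE.
Qed.

End SignedPermutations.

Arguments attach_signs {n}.
Arguments sign_at {n} : simpl never.

(** * Affine descents sorted by letter *)

Lemma signed_lt (s t : bool) (x y : nat) : x != y ->
  ((-1) ^+ t * y%:Z < (-1) ^+ s * x%:Z) = if (x < y)%N then t else ~~ s.
Proof. by case: s t => -[]; rewrite ?expr0 ?expr1; case: ltngtP => //; lia. Qed.

Lemma signed_add_gt0 (s t : bool) (x y : nat) : x != y ->
  (0 < (-1) ^+ s * x%:Z + (-1) ^+ t * y%:Z) = if (x < y)%N then ~~ t else ~~ s.
Proof. by case: s t => -[]; rewrite ?expr0 ?expr1; case: ltngtP => //; lia. Qed.

(* The number of affine descents decided by the sign s of the letter j.+1, namely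
   those comparing it to a letter of smaller absolute value.  The affine descent
   0 compares the same letters as the descent n, hence the factor 2 at j = m;
   at j = m.+1 exactly one of the two occurs, whatever the sign. *)
Definition charge (e : nat -> nat) (m j : nat) (s : bool) : nat :=
  (if j <= m then
     ((e j < e j.+1) && s) + (1 + (j == m)) * ((e j.+2 < e j.+1) && ~~ s)
   else e j < e j.+1)%N.

Lemma card_affDes m (u : 'S_m.+2) (eps : {ffun 'I_m.+2 -> bool}) :
  #|affDes (attach_signs u eps)| =
    (\sum_(j < m.+2) charge (entry u) m j (eps j))%N.
Proof.
have e_neq j : (j <= m.+2)%N -> entry u j != entry u j.+1 by exact: entry_neq.
have sgE (j : 'I_m.+2) : eps j = sign_at eps j.+1 by rewrite /sign_at valK.
under eq_bigr do rewrite sgE.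
rewrite /affDes -sum1dep_card [LHS]big_mkcond [LHS]big_ord_recl /=.
rewrite !sentry_attach_signs !subSS !subn0 signed_add_gt0 ?e_neq //.
set e := entry u; set s := sign_at eps.
rewrite [X in (_ + X)%N = _](_ : _ = \sum_(j < m.+2)
    (((e j < e j.+1) && s j.+1) + ((e j.+1 < e j) && ~~ s j)))%N; last first.
  apply: eq_bigr => j _; have := e_neq j (ltnW (ltn_ord j)).
  rewrite /bump add1n /= !sentry_attach_signs => neq_e.
  rewrite signed_lt // -/e -/s; move: neq_e.
  by rewrite -/e; case: ltngtP => //; case: (s j.+1); case: (s j).
(* The descents decided by the left letter are reindexed by that letter; the term for letter 0
   vanishes because its entry is 0. *)
rewrite big_split /= [X in (_ + (_ + X))%N]big_ord_recl ltn0 /= add0n.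
rewrite !big_ord_recr /= /charge leqnn ltnn eqxx /=.
rewrite [X in (_ = X + _ + _)%N](_ : _ =
    \sum_(j < m) ((e j < e j.+1) && s j.+1) +
    \sum_(j < m) ((e j.+2 < e j.+1) && ~~ s j.+1))%N; last first.
  rewrite -big_split; apply: eq_bigr => j _.
  by rewrite ltnW // (ltn_eqF (ltn_ord j)) mul1n.
have := e_neq m.+1 (leqnSn _); rewrite -/e /bump /=.
under [X in (_ + (_ + (X + _)))%N]eq_bigr do rewrite add1n.
set A := (\sum_(_ < m) _)%N; set B := (\sum_(_ < m) _)%N.
rewrite /= !add1n.
move: A B => A B.
case: (e m < e m.+1)%N; case: (ltngtP (e m.+1) (e m.+2)) => // _ _;
  by case: (s m.+1); case: (s m.+2) => /=; lia.
Qed.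

(** * Summing over the signs *)

Definition last_weight (a b c : nat) : {poly rat} :=
  ('X^(a < b)%N + 'X^(2 * (c < b))%N) * (2 * 'X^(b < c)%N).

(** Each charge depends on one sign only, so distributivity turns the sum over sign vectors into a
    product over letters. The charge of the last letter ignores its sign, whence the factor 2 in
    [last_weight]. *)
Lemma sum_signs m (u : 'S_m.+2) :
  \sum_(eps : {ffun 'I_m.+2 -> bool}) 'X^#|affDes (attach_signs u eps)|
  = \prod_(j < m) letter_weight (entry u) j
    * last_weight (entry u m) (entry u m.+1) (entry u m.+2).
Proof.
under eq_bigr => eps _ do rewrite card_affDes -prodrXr.
rewrite -(bigA_distr_bigA (fun (j : 'I_m.+2) s => 'X^(charge (entry u) m j s))).
under eq_bigr do rewrite big_bool.
rewrite !big_ord_recr /= -!mulrA; congr (_ * _).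
  apply: eq_bigr => j _; rewrite /charge /= ltnW // (ltn_eqF (ltn_ord j)).
  by rewrite !andbF !andbT muln0 addn0 mul1n.
rewrite /last_weight /charge leqnn ltnn eqxx !andbF !andbT muln0 addn0 /=.
by rewrite add0n mulr_natl mulr2n.
Qed.

Definition last_defect (a b c : nat) : {poly rat} :=
  ((b < c < a)%N%:R - (c < b < a)%N%:R) * (4 *: 'X).

(** The polynomial scaled by [phi u] is twice the product of the last two letter weights. If c < b <
    a, the defect is 2(1 + X^2) - 2(1 + X)^2 = -4X; if b < c < a, then [phi u] is 0 and the defect
    is all of [last_weight], 4X. In the other cases [phi u] is 1/2 and cancels the 2. *)
Lemma last_weightE m (u : 'S_m.+2)
    (a := entry u m) (b := entry u m.+1) (c := entry u m.+2) :
  last_weight a b c =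
    phi u *: (2 * (('X^(a < b)%N + 'X^(c < b)%N) * ('X^(b < c)%N + 'X)))
    + last_defect a b c.
Proof.
have ab : a != b by apply: entry_neq => //; rewrite !leqW.
have bc : b != c by apply: entry_neq.
rewrite /phi !subSS !subn0 -/a -/b -/c /last_weight /last_defect.
rewrite -!mul_polyC polyC_natr.
have halfK (p : {poly rat}) : (1 / 2)%:P * (2 * p) = p.
  by rewrite -(polyC_natr _ 2) mulrA -polyCM mul1r mulVf ?polyC1 ?mul1r.
case: (ltngtP a b) ab => // ab _; case: (ltngtP b c) bc => // bc _ /=.
- rewrite (leq_gtF (ltnW (ltn_trans ab bc))) halfK /=; ring.
- rewrite andbF halfK; ring.
- case: (c < a)%N => /=; rewrite ?polyC0 ?halfK; ring.
- rewrite polyC1; ring.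
Qed.

Lemma entry_tperm m (u : 'S_m.+2)
    (i := inord m : 'I_m.+2) (u' := (tperm i ord_max * u)%g) :
  [/\ forall j, (j <= m)%N -> entry u' j = entry u j,
      entry u' m.+1 = entry u m.+2 & entry u' m.+2 = entry u m.+1].
Proof.
have i_val : i = m :> nat by rewrite inordK // ltnW.
split.
- case=> // j lt_jm.
  have lt_jm2 : (j < m.+2)%N by apply: leq_trans lt_jm _; rewrite ltnW.
  rewrite !(entryS _ _ (Ordinal lt_jm2)) permM tpermD // -val_eqE /= ?i_val.
    by rewrite gtn_eqF.
  by rewrite gtn_eqF // ltnW.
- have := entryS _ u' i; rewrite i_val => ->.
  by rewrite permM tpermL -(entryS _ u ord_max).
- have := entryS _ u i; rewrite i_val => ->.
  by rewrite (entryS _ u' ord_max) permM tpermR.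
Qed.

Lemma sum_defect m :
  \sum_(u : 'S_m.+2) \prod_(j < m) letter_weight (entry u) j
    * last_defect (entry u m) (entry u m.+1) (entry u m.+2) = 0.
Proof.
set S := \sum_u _; suff : S = - S.
  move/eqP; rewrite -subr_eq0 opprK -mulr2n -mulr_natl mulf_eq0 -(polyC_natr _ 2).
  by rewrite polyC_eq0 => /eqP.
rewrite {1}/S (reindex_inj (mulgI (tperm (inord m : 'I_m.+2) ord_max))) /=.
rewrite -sumrN; apply: eq_bigr => u _.
have [eE u'_b u'_c] := entry_tperm m u; rewrite eE // u'_b u'_c -mulrN.
rewrite /last_defect -mulNr opprB.
set a := entry u m; set b := entry u m.+1; set c := entry u m.+2.
have [/andP[ba ca] | n_max] := boolP ((b < a) && (c < a))%N.
  congr (_ * _); apply: eq_bigr => -[j lt_jm] _; rewrite /letter_weight /=.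
  rewrite (eE j (ltnW lt_jm)) (eE j.+1 lt_jm).
  have [lt_j1m|ge_j1m] := ltnP j.+1 m; first by rewrite eE.
  (* The factor at [j.+1 = m] is the only one to involve the last two letters: it asks whether b <
     a, after the swap whether c < a, and here both hold. *)
  have -> : j.+1 = m by apply/eqP; rewrite eqn_leq lt_jm.
  by rewrite u'_b ba ca.
have /negbTE-> : ~~ (b < c < a)%N.
  by apply: contra n_max => /andP[bc ca]; rewrite ca (ltn_trans bc ca).
have /negbTE-> : ~~ (c < b < a)%N.
  by apply: contra n_max => /andP[cb ba]; rewrite ba (ltn_trans cb ba).
by rewrite subrr mul0r !mulr0.
Qed.

(** * The expansion over permutations *)

Lemma affine_Eulerian_expansion n : (2 <= n)%N ->
  affine_Eulerian n =
    \sum_(u : 'S_n)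
      phi u *: ((4 *: 'X) ^+ epk u * (1 + 'X) ^+ (n.+1 - 2 * epk u)).
Proof.
case: n => [|[|m]] // _.
rewrite /affine_Eulerian sum_signed_perms; under eq_bigr do rewrite sum_signs.
(* The defects add up to 0, so adding them on the right reduces the claim to an identity for each
   [u]. *)
rewrite -[RHS]addr0 -[X in _ = _ + X](sum_defect m) -big_split.
apply: eq_bigr => u _ /=.
rewrite last_weightE mulrDr; congr (_ + _).
have e_neq j : (j <= m.+2)%N -> entry u j != entry u j.+1 by exact: entry_neq.
have [] := prod_letter_weight (entry u) m.+2 (entry_gt0 _ u 0 isT) e_neq.
(* The entry after the last letter is 0, so here [d] is 1 and [2 ^+ d] is the 2 of
   [last_weightE]. *)
rewrite -epkE entry_out entry_gt0 // addn1 expr1 => _ <-.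
rewrite !big_ord_recr /= [letter_weight _ m]/letter_weight.
rewrite [letter_weight _ m.+1]/letter_weight.
by rewrite entry_out entry_gt0 // expr1 -scalerAr; congr (_ *: _); ring.
Qed.

(** * The gamma vector *)

Lemma epk_leq n (u : 'S_n) : (0 < n)%N -> (epk u < (n.+1)./2.+1)%N.
Proof.
case: n u => // n u _.
have e_neq j : (j <= n.+1)%N -> entry u j != entry u j.+1 by exact: entry_neq.
have [] := prod_letter_weight (entry u) n.+1 (entry_gt0 _ u 0 isT) e_neq.
by rewrite -epkE entry_out entry_gt0 // addn1 => le_p _; lia.
Qed.

(** The basis is triangular: the lowest term of its [i]-th element is X^i with coefficient 1. Once
    the earlier coefficients are known to vanish, the coefficient of X^k in the sum is [c k]. *)
Lemma gamma_basis_free d (c : {ffun 'I_(d./2).+1 -> rat}) :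
  \sum_(i < (d./2).+1) c i *: ('X^i * (1 + 'X) ^+ (d - 2 * i)) = 0 ->
  forall i, c i = 0.
Proof.
move=> sum0 [k]; elim/ltn_ind: k => k IHk lt_k.
have /(congr1 (fun p : {poly rat} => p`_k)) := sum0.
rewrite coef0 coef_sum (bigD1 (Ordinal lt_k)) //= big1 ?addr0.
  rewrite coefZ coefXnM ltnn subnn -horner_coef0 !hornerE /=.
  by rewrite expr1n mulr1.
move=> i; rewrite -val_eqE /= coefZ coefXnM neq_ltn => /orP[lt_ik | lt_ki].
  by case: i lt_ik => i lt_i /= lt_ik; rewrite IHk // mul0r.
by rewrite lt_ki mulr0.
Qed.

Lemma gamma_unique d (p : {poly rat}) (c1 c2 : {ffun 'I_(d./2).+1 -> rat}) :
  gamma_expansion p c1 -> gamma_expansion p c2 -> c1 = c2.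
Proof.
rewrite /gamma_expansion => E1 E2; apply/ffunP => i; apply/eqP; rewrite -subr_eq0.
have /(_ i) : forall i, (c1 - c2) i = 0; last by rewrite !ffunE => ->.
apply: gamma_basis_free; rewrite -[RHS](subrr p) {1}E1 E2.
by rewrite -sumrB; apply: eq_bigr => j _; rewrite -scalerBl !ffunE.
Qed.

Lemma phi_ge0 n (u : 'S_n) : 0 <= phi u.
Proof. by rewrite /phi; do 2 case: ifP => // _. Qed.

Theorem corollary5p9 (n : nat) (hn : (2 <= n)%N) :
  affine_Eulerian n =
    \sum_(u : 'S_n)
      phi u *: ((4 *: 'X) ^+ epk u * (1 + 'X) ^+ (n.+1 - 2 * epk u))
  /\ (exists! gamma : {ffun 'I_((n.+1)./2).+1 -> rat},
        gamma_expansion (affine_Eulerian n) gamma)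
  /\ (forall gamma : {ffun 'I_((n.+1)./2).+1 -> rat},
        gamma_expansion (affine_Eulerian n) gamma ->
        forall i, 0 <= gamma i).
Proof.
have E := affine_Eulerian_expansion n hn; split=> //.
pose gamma := [ffun i : 'I_((n.+1)./2).+1 =>
  \sum_(u : 'S_n | epk u == i) phi u * 4 ^+ i].
have gammaP : gamma_expansion (affine_Eulerian n) gamma.
  rewrite /gamma_expansion E.
  (* By [epk_leq] the number of peaks is in range, so [inord] never takes its default value. *)
  pose f (u : 'S_n) : 'I_((n.+1)./2).+1 := inord (epk u).
  rewrite (partition_big f xpredT) //= /f.
  apply: eq_bigr => i _; rewrite ffunE scaler_suml; apply: eq_big => u.
    by rewrite -val_eqE /= inordK // epk_leq // ltnW.
  move=> /eqP <-; rewrite inordK ?epk_leq 1?ltnW //.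
  by rewrite exprZn -scalerAl scalerA.
split=> [|c cP i].
  by exists gamma; split=> // c; apply: gamma_unique.
rewrite (gamma_unique _ _ _ _ cP gammaP) ffunE sumr_ge0 // => u _.
by rewrite mulr_ge0 ?phi_ge0 ?exprn_ge0.
Qed.
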